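(* Let $E=\{1,\ 7^2,\ 13^2,\ 17^2,\ 19^2,\ 23^2,\ 29^2,\ 31^2,\ 7\cdot 103,\ 1201,\ 7\cdot 127,\ 23\cdot 47\}$ (a set of residues modulo $1320$). For every prime number $n$ whose residue modulo $1320$ does not lie in $E$, there exist positive integers $a\le b\le c$ with $\frac{4}{n}=\frac{1}{a}+\frac{1}{b}+\frac{1}{c}$. Moreover, $$\mathbb N\setminus \mathcal C_3\subset \{n\in\mathbb N : (n \bmod 1320)\in E\}.$$
   Context: $\mathbb N$ denotes the positive integers. For $n\in\mathbb N$, a solution of $\frac{4}{n}=\frac{1}{a}+\frac{1}{b}+\frac{1}{c}$ means positive integers $a\le b\le c$ (not necessarily distinct) satisfying this equality. For $i\in\mathbb N$, $\mathcal C_i$ denotes the set of all $n\in\mathbb N$ for which this equation has a solution with $a\le \frac{n+4i-1}{4}$. *)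

(* Defs.v *)
From mathcomp Require Import all_boot all_order all_algebra.

Set Implicit Arguments.
Unset Strict Implicit.
Unset Printing Implicit Defensive.

Import Order.TTheory GRing.Theory Num.Theory.

Local Open Scope ring_scope.

Definition is_solution (n a b c : nat) : Prop :=
  [/\ (0 < a <= b)%N, (b <= c)%N
    & (4 / n%:R = 1 / a%:R + 1 / b%:R + 1 / c%:R :> rat)].

(* The bound on a is an inequality between rationals: no rounding takes
   place in (n + 4i - 1) / 4. *)
Definition calC (i n : nat) : Prop :=
  (0 < n)%N /\
  exists a b c : nat,
    is_solution n a b c /\ (a%:R <= (n%:R + 4 * i%:R - 1) / 4 :> rat).

Definition E : seq nat :=
  [:: 1; 7 ^ 2; 13 ^ 2; 17 ^ 2; 19 ^ 2; 23 ^ 2; 29 ^ 2; 31 ^ 2;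
      7 * 103; 1201; 7 * 127; 23 * 47]%N.

(* Main.v *)
(** Put 4 a = n + r with 0 < r <= 11, so that 4/n - 1/a = r/(n a) and a meets
    the bound defining C_3.  If x and y divide n a and x + y = r k, then
    r/(n a) = 1/(k n a / x) + 1/(k n a / y).  It is enough to look for x = p and
    y = q or y = q n, with p and q fixed integers: whether such a choice works
    depends only on n modulo 1320, and thirteen choices of (r, p, q) cover every
    residue outside E. *)
Require Import Defs.
From mathcomp Require Import all_boot all_order all_algebra.
From mathcomp Require Import ring lra zify.

Set Implicit Arguments.
Unset Strict Implicit.
Unset Printing Implicit Defensive.

Import Order.TTheory GRing.Theory Num.Theory.

(** Sorting can only replace [a] by something smaller in first place, so the bound on [a] passes to
    the least denominator. *)
Lemma calC_unsorted (i n a b c : nat) :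
  0 < n -> 0 < a -> 0 < b -> 0 < c ->
  (4 / n%:R = 1 / a%:R + 1 / b%:R + 1 / c%:R :> rat)%R ->
  (a%:R <= (n%:R + 4 * i%:R - 1) / 4 :> rat)%R ->
  calC i n.
Proof.
move=> n_gt0; wlog le_bc : b c / b <= c => [IH|] a_gt0 b_gt0 c_gt0 eq_n le_a.
  have [/IH|/ltnW/IH] := leqP b c; first exact.
  by apply=> //; rewrite eq_n addrAC.
split=> //; have [le_ab|/ltnW le_ba] := leqP a b.
  by exists a, b, c; split=> //; split=> //; rewrite a_gt0.
have le_b : (b%:R <= (n%:R + 4 * i%:R - 1) / 4 :> rat)%R.
  by apply: le_trans le_a; rewrite ler_nat.
have eq_n' : (4 / n%:R = 1 / b%:R + 1 / a%:R + 1 / c%:R :> rat)%R.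
  by rewrite eq_n [(1 / b%:R + _)%R]addrC.
have [le_ac|/ltnW le_ca] := leqP a c.
  by exists b, a, c; split=> //; split=> //; rewrite b_gt0.
exists b, c, a; split=> //; split; rewrite ?b_gt0 //.
by rewrite eq_n' addrAC.
Qed.

Lemma calC3_of_divisors (n r a x y : nat) :
  0 < n -> 0 < r <= 11 -> n + r = 4 * a ->
  x %| n * a -> y %| n * a -> r %| x + y -> calC 3 n.
Proof.
move=> n_gt0 /andP[r_gt0 r_le] def_a /dvdnP[x' def_x] /dvdnP[y' def_y].
move=> /dvdnP[k def_k].
have a_gt0 : 0 < a by lia.
have na_gt0 : 0 < n * a by rewrite muln_gt0 n_gt0.
have /andP[x'_gt0 x_gt0] : (0 < x') && (0 < x) by rewrite -muln_gt0 -def_x.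
have /andP[y'_gt0 y_gt0] : (0 < y') && (0 < y) by rewrite -muln_gt0 -def_y.
have k_gt0 : 0 < k by case: k def_k => //; lia.
apply: (@calC_unsorted 3 n a (k * x') (k * y')) => //; rewrite ?muln_gt0 ?k_gt0 //.
  have nz m : 0 < m -> (m%:R != 0 :> rat)%R by rewrite pnatr_eq0 -lt0n.
  have inv_factor z z' : n * a = z' * z -> 0 < z' ->
      (1 / (k * z')%:R = z%:R / (k%:R * (n * a)%:R) :> rat)%R.
    move=> def_z z'_gt0; have z_gt0 : 0 < z.
      by move: na_gt0; rewrite def_z muln_gt0 => /andP[].
    by rewrite def_z !natrM; field; rewrite !nz.
  rewrite (inv_factor x x') // (inv_factor y y') // -addrA -mulrDl -natrD def_k.
  have def_aR : (4 * a%:R = n%:R + r%:R :> rat)%R by rewrite -natrD def_a natrM.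
  have -> : (4 / n%:R = 4 * a%:R / (n%:R * a%:R) :> rat)%R.
    by field; rewrite !nz.
  by rewrite def_aR !natrM; field; rewrite !nz.
(* For [i = 3] the bound reads [4 * a <= n + 4 * 3 - 1 = n + 11], which is why [r] stops at 11. *)
have : (4 * a%:R <= n%:R + 11 :> rat)%R.
  by rewrite -natrM -(natrD _ n 11) ler_nat -def_a leq_add2l.
lra.
Qed.

(* Divisibility of n a by p is tested without computing n a = n (n + r) / 4,
   as p %| n or 4 p %| n + r. *)
Definition covers (r p q : nat) (e : bool) (n : nat) : bool :=
  [&& 4 %| n + r,
      (p %| n) || (4 * p %| n + r),
      (~~ e && (q %| n)) || (4 * q %| n + r)
    & r %| p + q * n ^ e].

Lemma calC3_of_covers (r p q : nat) (e : bool) (n : nat) :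
  0 < n -> 0 < r <= 11 -> covers r p q e n -> calC 3 n.
Proof.
move=> n_gt0 r_bd /and4P[/dvdnP[a def_a] p_dvd q_dvd r_dvd].
have {}def_a : n + r = 4 * a by rewrite mulnC.
rewrite def_a !dvdn_pmul2l // in p_dvd q_dvd.
apply: (calC3_of_divisors n_gt0 r_bd def_a _ _ r_dvd).
  by case/orP: p_dvd => ?; [apply: dvdn_mulr | apply: dvdn_mull].
(* For [e] true, [y = q * n] already uses up the factor [n] of [n * a], so [q] has to divide [a]. *)
case: e q_dvd {r_dvd} => /= [q_a|]; first by rewrite expn1 mulnC dvdn_mul.
by rewrite muln1 => /orP[?|?]; [apply: dvdn_mulr | apply: dvdn_mull].
Qed.

(** For [e] false the last test of [covers] is [r %| p + q], free of [n]; this admits [r = 7], which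
    does not divide 1320. *)
Definition periodic_choice (m r p q : nat) (e : bool) : bool :=
  [&& 4 * p %| m, 4 * q %| m & e ==> (r %| m)].

Lemma covers_mod (m r p q : nat) (e : bool) (n : nat) :
  periodic_choice m r p q e -> covers r p q e (n %% m) = covers r p q e n.
Proof.
case/and3P=> p_m q_m r_m.
have dvd_mod d s : d %| m -> (d %| n %% m + s) = (d %| n + s).
  by move=> d_m; rewrite /dvdn -modnDml modn_dvdm // modnDml.
have dvd_mod0 d : d %| m -> (d %| n %% m) = (d %| n).
  by move=> d_m; rewrite -[n %% m]addn0 dvd_mod // addn0.
rewrite /covers !dvd_mod ?dvd_mod0 //; first last.
- by apply: dvdn_trans p_m; apply: dvdn_mulr.
- by apply: dvdn_trans p_m; apply: dvdn_mull.
- by apply: dvdn_trans q_m; apply: dvdn_mull.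
congr [&& _, _, _ & _]; case: e r_m => //= r_m.
by rewrite !expn1 /dvdn -modnDmr -modnMmr modn_dvdm // modnMmr modnDmr.
Qed.

(** The first three entries settle n = 3, 2, 0 modulo 4. The others have r = 3 modulo 4 and serve n
    = 1 modulo 4. The lcm of all [4 * p], [4 * q], and of [r] where [e] is true, is 1320. *)
Definition choices : seq (nat * nat * nat * bool) :=
  [:: (1, 1, 1, false); (2, 1, 1, false); (4, 2, 2, false);
      (3, 2, 1, false); (3, 5, 1, false); (3, 11, 1, false);
      (3, 1, 1, true); (3, 3, 1, true); (7, 5, 2, false);
      (11, 1, 1, true); (11, 1, 3, true); (11, 1, 5, true);
      (11, 5, 1, true)].

Lemma choices_valid :
  all (fun '(r, p, q, e) => (0 < r <= 11) && periodic_choice 1320 r p q e)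
    choices.
Proof. by vm_compute. Qed.

(** A finite check: by [covers_mod] each residue stands for its whole class, 0 for the multiples of
    1320. *)
Lemma choices_cover :
  all (fun s => (s \in E) || has (fun '(r, p, q, e) => covers r p q e s) choices)
    (iota 0 1320).
Proof. by vm_compute. Qed.

Lemma calC3_notin_E (n : nat) : 0 < n -> n %% 1320 \notin E -> calC 3 n.
Proof.
move=> n_gt0 nE; have /allP/(_ (n %% 1320)) := choices_cover.
rewrite mem_iota ltn_mod (negPf nE) => /(_ isT) /hasP[[[[r p] q] e] in_choices].
have /allP/(_ _ in_choices)/andP[r_bd periodic] := choices_valid.
by rewrite covers_mod //; apply: calC3_of_covers.
Qed.

Theorem theorem2p1 :
  (forall n : nat, prime n -> (n %% 1320)%N \notin E ->
     exists a b c : nat, is_solution n a b c) /\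
  (forall n : nat, (0 < n)%N -> ~ calC 3 n -> (n %% 1320)%N \in E).
Proof.
split=> [n /prime_gt0 n_gt0 nE | n n_gt0 not_C3].
  have [_ [a [b [c [sol _]]]]] := calC3_notin_E n_gt0 nE.
  by exists a, b, c.
by case: (boolP (_ \in E)) => // nE; case: not_C3; apply: calC3_notin_E.
Qed.
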